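(* Let $L,M$ be metric spaces and let $(f_i:L\to M)_{i\in\mathbb N}$ be a sequence of uniformly continuous functions. The sequence $(f_i)$ is uniformly Cauchy if and only if the maps $\mathbb N^n\times L^n\to M^n$, $(i_1,\dots,i_n,x_1,\dots,x_n)\mapsto(f_{i_1}(x_1),\dots,f_{i_n}(x_n))$ $(n\ge1)$, form a morphism $\mathbb N^{\bullet}_{cof}\times L_{u}\to M_{u}$ in $\mathrm{sFilt}$.
   Context: A filter on a set $X$ is a collection of subsets of $X$, called neighbourhoods, closed under finite intersections (in particular containing $X$) and under passing to supersets; $\emptyset$ is allowed to be a neighbourhood and $X$ is allowed to be empty. A morphism of filters (a continuous map) is a function of the underlying sets such that the preimage of every neighbourhood is a neighbourhood. $\mathrm{Filt}$ is the category of filters. $\Delta$ is the category of finite linear orders $n_\le=\{0<\dots<n-1\}$, $n\ge 1$, and non-decreasing maps, and $\mathrm{sFilt}=\mathrm{Fun}(\Delta^{op},\mathrm{Filt})$ is the category of simplicial filters; a morphism in $\mathrm{sFilt}$ is a map of the underlying simplicial sets which is continuous at every level. Products in $\mathrm{sFilt}$ are levelwise products of filters (a neighbourhood in the product is a set containing a product of neighbourhoods). For a metric space $M$, $M_{u}\in\mathrm{sFilt}$ has underlying simplicial set $n_\le\mapsto \mathrm{Hom}_{\mathrm{Sets}}(n,M)=M^n$, and $\varepsilon\subset M^n$ is a neighbourhood iff there is $\epsilon>0$ such that $(x_1,\dots,x_n)\in\varepsilon$ whenever $\mathrm{dist}(x_i,x_j)<\epsilon$ for all $i,j$. $\mathbb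 N^{\bullet}_{cof}\in\mathrm{sFilt}$ has underlying simplicial set $n_\le\mapsto\mathbb N^n$, where a subset of $\mathbb N^n$ is a neighbourhood iff it contains $\{(i_1,\dots,i_n): i_1,\dots,i_n>N\}$ for some $N$. Uniformly Cauchy means: for every $\epsilon>0$ there is $N$ such that $\mathrm{dist}(f_n(x),f_m(x))<\epsilon$ for all $n,m>N$ and all $x\in L$. *)

(* Defs.v *)
From mathcomp Require Import all_boot all_order all_algebra.
From mathcomp Require Import boolp classical_sets filter reals.
From mathcomp Require Import topology_structure uniform_structure.
From mathcomp Require Import pseudometric_structure metric_structure.

Set Implicit Arguments.
Unset Strict Implicit.
Unset Printing Implicit Defensive.

Import Order.TTheory GRing.Theory Num.Theory.
Local Open Scope classical_set_scope.
Local Open Scope ring_scope.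

(* [Filter], unlike [ProperFilter], allows the empty set as a neighbourhood, and
   the underlying type may be empty. *)
Record filt := Filt {
  filt_set :> Type;
  neighbourhoods : set_system filt_set;
  filt_filter : Filter neighbourhoods
}.

Arguments neighbourhoods : clear implicits.

Definition filt_continuous (X Y : filt) (f : X -> Y) : Prop :=
  forall V : set Y, neighbourhoods Y V -> neighbourhoods X (f @^-1` V).

Record filt_hom (X Y : filt) := FiltHom {
  filt_fun :> X -> Y;
  filt_funP : filt_continuous filt_fun
}.

Definition filt_prod (X Y : filt) : filt :=
  Filt (filter_prod_filter (filt_filter X) (filt_filter Y)).

(* Delta is represented by its skeleton: its objects are the orders 'I_n.+1,
   so the index n : nat stands for the linear order with n.+1 elements, and its
   maps are the order morphisms {omorphism 'I_m.+1 -> 'I_n.+1}. *)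
Record sfilt := SFilt {
  sf_obj :> nat -> filt;
  sf_map : forall m n : nat,
    {omorphism 'I_m.+1 -> 'I_n.+1} -> filt_hom (sf_obj n) (sf_obj m);
  sf_map_id : forall (n : nat) (x : sf_obj n), sf_map idfun x = x;
  sf_map_comp : forall (m n p : nat) (g : {omorphism 'I_n.+1 -> 'I_p.+1})
    (f : {omorphism 'I_m.+1 -> 'I_n.+1}) (x : sf_obj p),
    sf_map (g \o f) x = sf_map f (sf_map g x)
}.

Definition simplicial_map (X Y : sfilt) (phi : forall n : nat, X n -> Y n) :
    Prop :=
  forall (m n : nat) (f : {omorphism 'I_m.+1 -> 'I_n.+1}) (x : X n),
    phi m (sf_map X f x) = sf_map Y f (phi n x).

Definition sfilt_morphism (X Y : sfilt) (phi : forall n : nat, X n -> Y n) :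
    Prop :=
  simplicial_map phi /\ forall n : nat, filt_continuous (phi n).

Section Product.
Variables X Y : sfilt.

Let obj (n : nat) : filt := filt_prod (X n) (Y n).

Let act m n (f : {omorphism 'I_m.+1 -> 'I_n.+1}) (z : obj n) : obj m :=
  (sf_map X f z.1, sf_map Y f z.2).

Let act_continuous m n (f : {omorphism 'I_m.+1 -> 'I_n.+1}) :
  filt_continuous (act f).
Proof.
move=> V [[A B] /= [XA YB] ABV].
exists (sf_map X f @^-1` A, sf_map Y f @^-1` B) => /=.
  by split; apply: filt_funP.
by move=> [x y] /= [Ax By]; apply: ABV.
Qed.

Let act_id n (z : obj n) : act idfun z = z.
Proof. by case: z => x y; rewrite /act /= !sf_map_id. Qed.

Let act_comp m n p (g : {omorphism 'I_n.+1 -> 'I_p.+1})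
    (f : {omorphism 'I_m.+1 -> 'I_n.+1}) (z : obj p) :
  act (g \o f) z = act f (act g z).
Proof. by rewrite /act /= !sf_map_comp. Qed.

Definition sfilt_prod : sfilt :=
  @SFilt obj (fun m n f => FiltHom (@act_continuous m n f)) act_id act_comp.

End Product.

(* The simplicial set n |-> Hom(n, T), on which Delta acts by precomposition,
   together with a filter on every T^n. *)
Definition hom_sfilt (T : Type) (F : forall n, set_system ('I_n.+1 -> T))
    (FF : forall n, Filter (F n))
    (Fcont : forall m n (f : {omorphism 'I_m.+1 -> 'I_n.+1}),
      @filt_continuous (Filt (FF n)) (Filt (FF m)) (fun x => x \o f)) : sfilt :=
  @SFilt (fun n => Filt (FF n)) (fun m n f => FiltHom (Fcont m n f))
    (fun n x => erefl) (fun m n p g f x => erefl).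

Section MetricSFilt.
Variables (R : realType) (M : metricType R).

Definition metric_nbhs (n : nat) : set_system ('I_n.+1 -> M) :=
  filter_from [set e : R | 0 < e]
    (fun e => [set x | forall i j, mdist (x i) (x j) < e]).

Lemma metric_nbhs_filter n : Filter (@metric_nbhs n).
Proof.
apply: filter_from_filter; first by exists 1; exact: ltr01.
move=> a b /= a0 b0; exists (Order.min a b); first by rewrite /= lt_min a0 b0.
by move=> x /= xab; split=> i j; have := xab i j; rewrite lt_min => /andP[].
Qed.

Lemma metric_nbhs_continuous m n (f : {omorphism 'I_m.+1 -> 'I_n.+1}) :
  @filt_continuous (Filt (metric_nbhs_filter n))
    (Filt (metric_nbhs_filter m)) (fun x => x \o f).
Proof.
by move=> V [e e0 eV]; exists e => // x xe; apply: eV => i j; apply: xe.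
Qed.

Definition metric_sfilt : sfilt := hom_sfilt metric_nbhs_continuous.

End MetricSFilt.

Definition cof_nbhs (n : nat) : set_system ('I_n.+1 -> nat) :=
  filter_from [set: nat] (fun N => [set i | forall k, (N < i k)%N]).

Lemma cof_nbhs_filter n : Filter (@cof_nbhs n).
Proof.
apply: filter_from_filter; first by exists 0%N.
move=> a b _ _; exists (maxn a b) => // i /= iab.
by split=> k; have := iab k; rewrite gtn_max => /andP[].
Qed.

Lemma cof_nbhs_continuous m n (f : {omorphism 'I_m.+1 -> 'I_n.+1}) :
  @filt_continuous (Filt (cof_nbhs_filter n))
    (Filt (cof_nbhs_filter m)) (fun x => x \o f).
Proof.
by move=> V [N _ NV]; exists N => // i iN; apply: NV => k; apply: iN.
Qed.

Definition nat_cof_sfilt : sfilt := hom_sfilt cof_nbhs_continuous.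

Definition uniformly_cauchy (R : realType) (L : Type) (M : metricType R)
    (f : nat -> L -> M) : Prop :=
  forall e : R, 0 < e -> exists N : nat, forall n m : nat,
    (N < n)%N -> (N < m)%N -> forall x : L, mdist (f n x) (f m x) < e.

(* (i_1, ..., i_n, x_1, ..., x_n) |-> (f_{i_1}(x_1), ..., f_{i_n}(x_n)) *)
Definition sequence_map (R : realType) (L M : metricType R) (f : nat -> L -> M)
    (n : nat) (z : sfilt_prod nat_cof_sfilt (metric_sfilt L) n) :
    metric_sfilt M n :=
  fun k => f (z.1 k) (z.2 k).

(* Main.v *)
Require Import Defs.
From mathcomp Require Import all_boot all_order all_algebra.
From mathcomp Require Import boolp classical_sets filter.
From mathcomp Require Import reals uniform_structure pseudometric_structure.
From mathcomp Require Import metric_structure lra.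

Set Implicit Arguments.
Unset Strict Implicit.
Unset Printing Implicit Defensive.

Import Order.TTheory GRing.Theory Num.Theory.
Local Open Scope classical_set_scope.
Local Open Scope ring_scope.

(** Compare f_i(x) with f_j(y) through a single f_c(x), f_c(y), where c lies
    beyond the Cauchy threshold: only the modulus of continuity of f_c matters.
    Conversely, continuity on pairs (level 2), evaluated at ((n, m), (x, x)),
    is the uniform Cauchy condition because dist(x, x) = 0. *)

Lemma unif_continuous_mdist (R : realType) (L M : metricType R) (g : L -> M) :
  unif_continuous g -> forall e : R, 0 < e ->
  exists2 d : R, 0 < d & forall x y, mdist x y < d -> mdist (g x) (g y) < e.
Proof.
move=> /unif_continuousP gu e e0.
have [d /= d0 dg] := gu e e0.
exists d => // x y xy; have := dg (x, y).
by rewrite /= !ballEmdist /=; apply.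
Qed.

Lemma sequence_map_continuous (R : realType) (L M : metricType R)
    (f : nat -> L -> M) (f_unif : forall i, unif_continuous (f i)) (n : nat) :
  uniformly_cauchy f -> filt_continuous (@sequence_map R L M f n).
Proof.
move=> fC V [e /= e0 eV].
have e3 : 0 < e / 3 by rewrite divr_gt0.
have [N fN] := fC _ e3.
(* [N.+1] is the first index beyond the threshold. Since [d] comes from this single function, it
   serves for every [i k] at once. *)
have [d d0 fd] := unif_continuous_mdist (f_unif N.+1) e3.
exists ([set i | forall k, (N < i k)%N],
        [set x | forall i j, mdist (x i) (x j) < d]).
  by split; [exists N | exists d].
move=> [i x] /= [iN xd]; apply: eV => k l; rewrite /sequence_map /=.
have h1 := fN _ _ (iN k) (ltnSn N) (x k).
have h2 := fd _ _ (xd k l).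
have h3 := fN _ _ (ltnSn N) (iN l) (x l).
(* Both detours give the chain [f (i k) (x k)], [f N.+1 (x k)], [f N.+1 (x l)], [f (i l) (x l)],
   with each link below [e / 3]. *)
have t1 := metric_triangle (f (i k) (x k)) (f N.+1 (x k)) (f (i l) (x l)).
have t2 := metric_triangle (f N.+1 (x k)) (f N.+1 (x l)) (f (i l) (x l)).
lra.
Qed.

Lemma continuous_uniformly_cauchy (R : realType) (L M : metricType R)
    (f : nat -> L -> M) :
  filt_continuous (@sequence_map R L M f 1) -> uniformly_cauchy f.
Proof.
move=> fC e e0.
have [] := fC [set y | forall i j, mdist (y i) (y j) < e]; first by exists e.
(* [N] is read off [A] before [x] is introduced, hence the uniformity over [L]. *)
move=> [A B] /= [[N _ NA] [d /= d0 dB]] ABe; exists N => n m nN mN x.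
pose i (k : 'I_2) := if k == ord0 then n else m.
suff ABi : (A `*` B) (i, fun=> x) by exact: ABe ABi ord0 ord_max.
split=> /=; first by apply: NA => k /=; rewrite /i; case: ifP.
by apply: dB => k l /=; rewrite mdistxx.
Qed.

Theorem mainTheorem4 (R : realType) (L M : metricType R) (f : nat -> L -> M)
  (f_unif : forall i : nat, unif_continuous (f i)) :
  uniformly_cauchy f <->
  @sfilt_morphism (sfilt_prod nat_cof_sfilt (metric_sfilt L)) (metric_sfilt M)
    (sequence_map f).
Proof.
(* Index [1] stands for the two-element order, so [fC 1%N] is continuity on pairs. *)
split=> [fC | [_ fC]]; last exact: continuous_uniformly_cauchy (fC 1%N).
(* Simpliciality holds by computation: both structures act by precomposition. *)
by split=> // n; exact: sequence_map_continuous.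
Qed.
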